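(* Let $0<\varepsilon<1$. For every instance, every optimal schedule $\mathrm{OPT}$ for the total flow time objective, and every time $t$, $$|\mathrm{SLF}(t)|\le \lceil 1/\varepsilon\rceil\cdot|\mathrm{OPT}(t)|,$$ where $\mathrm{SLF}(t)$ and $\mathrm{OPT}(t)$ denote the sets of jobs that are active at time $t$ in the schedule of the algorithm SLF and in the optimal schedule, respectively.
   Context: **Problem.** An instance is a finite set of jobs. Job $j$ has a release (arrival) time $\ge 0$ and a processing time $p_j>0$. A single machine of unit speed processes the jobs; preemption is allowed at no cost, and the machine may be time-shared (job rates are nonnegative and sum to at most $1$). A job may only be processed after its release and completes when it has received $p_j$ units of processing. A job is active at time $t$ in a schedule if it has been released (release time at most $t$) and is not finished at time $t$. The flow time of a job is its completion time minus its release time; an optimal schedule (computed offline with full knowledge of the instance) minimizes the sum of the flow times of all jobs. **Algorithm SLF (Shortest Lower-Bound First).** At time $t$, in the schedule of SLF, let $e_j(t)$ be the amount of processing job $j$ has received up to time $t$ and $r_j(t)=p_j-e_j(t)$ its remaining processing time. An active job $j$ is *known* at time $t$ if $r_j(t)\le \varepsilon p_j$ and *unknown* otherwise; $K(t)$ and $U(t)$ denote the sets of known and unknown active jobs. The estimate of an active job is $\eta_j(t)=\frac{\varepsilon}{1-\varepsilon}e_j(t)$ if $j\in U(t)$ and $\eta_j(t)=r_j(t)$ if $j\in K(t)$. At each time $t$ with at least one active job, SLF does the following, where a minimum over the empty set is $+\infty$: 1. If $\min_{j\in K(t)}\eta_j(t)\le\min_{j\in U(t)}\eta_j(t)$, it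 processes an arbitrary known job with minimum $\eta_j(t)$. 2. Otherwise, it processes all unknown jobs with minimum $\eta_j(t)$ in parallel at an equal rate (Round-Robin with infinitesimally small steps). *)

(* Defs.v *)
From HB Require Import structures.
From mathcomp Require Import all_boot all_order all_algebra.
From mathcomp Require Import all_classical all_reals all_analysis.

Set Implicit Arguments.
Unset Strict Implicit.
Unset Printing Implicit Defensive.

Import Order.TTheory GRing.Theory Num.Theory.
Import numFieldNormedType.Exports.

Local Open Scope classical_set_scope.
Local Open Scope ring_scope.

Record instance (R : realType) (J : finType) := Instance {
  release : J -> R;
  proc : J -> R;
  release_ge0 : forall j, 0 <= release j;
  proc_gt0 : forall j, 0 < proc j }.

Section Scheduling.
Variables (R : realType) (J : finType) (I : instance R J).

(* A schedule is given by its rate functions: [x j t] is the fraction of the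
   machine devoted to job [j] at time [t]. *)
Implicit Types (x y : J -> R -> R) (j : J) (t : R).

Definition received x j t : R := \int[lebesgue_measure]_(s in `[0, t]) x j s.

(* Times range over all of [R]; as release times are nonnegative,
   [sched_release] forces the rates to vanish at negative times. *)
Record is_schedule x : Prop := IsSchedule {
  sched_measurable : forall j, measurable_fun setT (x j);
  sched_ge0 : forall j t, 0 <= x j t;
  sched_speed : forall t, \sum_j x j t <= 1;
  sched_release : forall j t, t < release I j -> x j t = 0;
  sched_proc : forall j t, received x j t <= proc I j }.

Definition active x t : {set J} :=
  [set j | (release I j <= t) && (received x j t < proc I j)]%SET.

(* The completion time is [+oo] for a job that is never completed. *)
Definition completion x j : \bar R :=
  ereal_inf [set t%:E | t in [set t | proc I j <= received x j t]].

Definition flow_time x j : \bar R := (completion x j - (release I j)%:E)%E.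

Definition total_flow_time x : \bar R := (\sum_j flow_time x j)%E.

Definition is_optimal y : Prop :=
  is_schedule y /\
  forall x, is_schedule x -> (total_flow_time y <= total_flow_time x)%E.

Section SLF.
Variable eps : R.

Definition remaining x j t : R := proc I j - received x j t.

Definition known x t : {set J} :=
  [set j in active x t | remaining x j t <= eps * proc I j]%SET.

Definition unknown x t : {set J} :=
  [set j in active x t | ~~ (remaining x j t <= eps * proc I j)]%SET.

Definition estimate x j t : R :=
  if j \in unknown x t then eps / (1 - eps) * received x j t
  else remaining x j t.

Definition min_estimate x t (A : {set J}) : \bar R :=
  \big[Order.min/+oo%E]_(j in A) (estimate x j t)%:E.

Definition argmin_estimate x t (A : {set J}) : {set J} :=
  [set j in A | (estimate x j t)%:E == min_estimate x t A]%SET.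

Definition SLF_rule x t : Prop :=
  if (min_estimate x t (known x t) <= min_estimate x t (unknown x t))%E then
    exists2 k, k \in argmin_estimate x t (known x t) &
      forall j, x j t = if j == k then 1 else 0
  else
    forall j, x j t =
      if j \in argmin_estimate x t (unknown x t)
      then #|argmin_estimate x t (unknown x t)|%:R^-1 else 0.

(* "Round-Robin with infinitesimally small steps" is rendered by equal rates
   on the set of all unknown jobs whose estimate is currently minimum. *)
Definition is_SLF x : Prop :=
  is_schedule x /\ forall t, active x t != finset.set0 -> SLF_rule x t.

End SLF.
End Scheduling.

(* Main.v *)
Require Import Defs.
From mathcomp Require Import all_boot all_order all_algebra.
From mathcomp Require Import all_classical all_reals all_analysis.
From mathcomp Require Import measurable_realfun lra ring.

(* Compare SLF with a schedule [y]: fix [k >= 1 / eps] and the set [Q] of jobs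
   active in [y] at time [t].
   The estimate of an active job is [min (eps / (1 - eps) * e) (p - e)], a
   lower bound on its remaining time. For a level [th >= 0] give each job the
   credit [max (min p (th / eps) - e) (min (p - e) th)]: it decreases at the
   rate at which the job is processed, as long as its estimate is at most
   [th], and equals [th] when the estimate is at least [th]. The claim is that
   at every time [s <= t] and for every [th] the total credit of the released
   jobs is at most [k th] times the number of released jobs of [Q] plus the
   volume that [y] still has to process on the other released jobs. At time
   [t] that volume is 0, and letting [th] be small gives the theorem.
   Releases preserve the claim, and so does processing by SLF at level at most
   [th], since the credit then decreases at rate 1 and the volume of [y] at
   rate at most 1. If the claim fails by [c > 0], consider the first time at
   which it fails by at least [c] for some [th], and take the worst [th] there:
   just before that time SLF worked at level at most [th], so the claim
   already failed by [c] earlier, a contradiction. *)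

Set Implicit Arguments.
Unset Strict Implicit.
Unset Printing Implicit Defensive.

Import Order.TTheory GRing.Theory Num.Theory.
Import numFieldNormedType.Exports.
Local Open Scope classical_set_scope.
Local Open Scope ring_scope.

(** * Integration of bounded measurable rates *)

Section BoundedFunctions.
Variable R : realType.
Implicit Types (f g : R -> R) (a b : R).
Notation mu := (@lebesgue_measure R).

Lemma bounded_integrable_itv f a b (b1 b2 : bool) :
  measurable_fun setT f -> (forall t, `|f t| <= 1) ->
  mu.-integrable [set` Interval (BSide b1 a) (BSide b2 b)] (EFin \o f).
Proof.
move=> mf bf; apply: measurable_bounded_integrable => //=.
- rewrite lebesgue_measure_itv/=.
  by case: ifPn => // _; rewrite -EFinB ltry.
- exact: measurable_funS mf.
- exists 1; split; rewrite ?num_real // => M M1 x _ /=.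
  exact: le_trans (bf x) (ltW M1).
Qed.

Lemma bounded_locally_integrable f :
  measurable_fun setT f -> (forall t, `|f t| <= 1) ->
  locally_integrable [set: R] f.
Proof.
move=> mf bf; split=> //; first exact: openT.
move=> K _ cK; have mK := compact_measurable cK.
have : mu.-integrable K (EFin \o f).
  apply: measurable_bounded_integrable => //=.
  - exact: compact_finite_measure.
  - exact: measurable_funS mf.
  - exists 1; split; rewrite ?num_real // => M M1 x _ /=.
    exact: le_trans (bf x) (ltW M1).
by case/integrableP.
Qed.

Lemma Rintegral_sum (J : finType) (P : pred J) (h : J -> R -> R) (D : set R) :
  measurable D -> (forall j, mu.-integrable D (EFin \o h j)) ->
  \int[mu]_(s in D) (\sum_(j | P j) h j s) = \sum_(j | P j) \int[mu]_(s in D) h j s.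
Proof.
move=> mD ih; rewrite /Rintegral sum_fine; last first.
  by move=> j _; apply: integrable_fin_num => //; exact: ih.
congr fine.
rewrite -(@integral_sum _ _ R mu D mD J (fun j => EFin \o h j) ih).
by apply: eq_integral => s _; rewrite sumEFin.
Qed.

(* By Lebesgue differentiation the two rates agree almost everywhere, so both
   vanish there. *)
Lemma integral_eq_disjoint f g a b : 0 <= a -> a < b ->
  measurable_fun setT f -> measurable_fun setT g ->
  (forall t, 0 <= f t <= 1) -> (forall t, 0 <= g t <= 1) ->
  (forall t, a < t < b -> f t * g t = 0) ->
  (forall t, a <= t <= b ->
     \int[mu]_(s in `[0, t]) f s - \int[mu]_(s in `[0, t]) g s = \int[mu]_(s in `[0, a]) f s - \int[mu]_(s in `[0, a]) g s) ->
  \int[mu]_(s in `]a, b[) f s = 0.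
Proof.
move=> a0 ab mf mg f01 g01 fg0 FG.
have bf t : `|f t| <= 1 by case/andP: (f01 t) => ? ?; rewrite ger0_norm.
have bg t : `|g t| <= 1 by case/andP: (g01 t) => ? ?; rewrite ger0_norm.
pose h := f \- g.
have mh : measurable_fun setT h by exact: measurable_funB.
have bh t : `|h t| <= 1.
  by rewrite /h/= ler_norml; move: (f01 t) (g01 t) => /andP[? ?] /andP[? ?]; lra.
have intH (y : R) : \int[mu]_(s in `[0, y]) h s =
    \int[mu]_(s in `[0, y]) f s - \int[mu]_(s in `[0, y]) g s.
  by rewrite RintegralB//; exact: bounded_integrable_itv.
have := @FTC1 R h (BLeft 0) (fun y => bounded_integrable_itv _ _ _ _ mh bh)
  (bounded_locally_integrable mh bh).
rewrite /=; set H := fun x => \int[mu]_(t in `[0, x]) h t => aeH.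
suff ae0 : {ae mu, forall x, `]a, b[%classic x -> (EFin \o f) x = (cst 0%E) x}.
  rewrite /Rintegral (ae_eq_integral (cst 0%E))//.
  - by rewrite integral0.
  - exact/measurable_EFinP/measurable_funTS.
move: aeH; apply: filterS; first exact: (ae_filter_ringOfSetsType mu).
move=> x /= + /[!in_itv]/= /andP[ax xb].
move=> /(_ _)[|_]; first by rewrite lte_fin (le_lt_trans a0).
have -> : derive1 H x = 0.
  have cH : {near x, H =1 cst (H a)}.
    near=> y; rewrite /H/= !intH FG//.
    have : y \in `]a, b[ by near: y; apply: near_in_itvoo; rewrite in_itv/= ax.
    by rewrite in_itv/= => /andP[? ?]; lra.
  rewrite derive1E (near_eq_derive _ cH) ?oner_neq0//.
  by rewrite derive_cst.
move/esym/eqP; rewrite /h/= subr_eq0 => /eqP fgx.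
have := fg0 x; rewrite ax xb => /(_ isT)/eqP; rewrite -fgx mulf_eq0 orbb.
by move=> /eqP ->.
Unshelve. all: by end_near. Qed.
End BoundedFunctions.

(** * Received processing in an arbitrary schedule *)

Section Schedules.
Variables (R : realType) (J : finType) (I : instance R J) (x : J -> R -> R).
Hypothesis xP : is_schedule I x.
Notation mu := (@lebesgue_measure R).
Implicit Types (j : J) (s t u v : R).

Lemma sum_rate_le1 (P : pred J) t : \sum_(j | P j) x j t <= 1.
Proof.
apply: le_trans (sched_speed xP t); rewrite [leRHS](bigID P)/= lerDl.
by apply: sumr_ge0 => j _; exact: sched_ge0 xP _ _.
Qed.

Lemma rate_le1 j t : x j t <= 1.
Proof. by have := sum_rate_le1 (pred1 j) t; rewrite big_pred1_eq. Qed.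

Lemma rate_norm_le1 j t : `|x j t| <= 1.
Proof. by rewrite ger0_norm ?rate_le1// (sched_ge0 xP). Qed.

Lemma rate_integrable j u v (b1 b2 : bool) :
  mu.-integrable [set` Interval (BSide b1 u) (BSide b2 v)] (EFin \o x j).
Proof.
apply: bounded_integrable_itv; last exact: rate_norm_le1.
exact: sched_measurable xP _.
Qed.

Lemma received_at_le0 j t : t <= 0 -> received x j t = 0.
Proof.
move=> t0; rewrite /received.
have [->|tn0] := eqVneq t 0; first by rewrite set_itv1 Rintegral_set1.
by rewrite set_itv_ge ?Rintegral_set0// bnd_simp -ltNge lt_neqAle tn0.
Qed.

Lemma receivedB j u v : 0 <= u -> u <= v ->
  received x j v - received x j u = \int[mu]_(s in `]u, v[) x j s.
Proof.
move=> u0 uv; rewrite /received Rintegral_itvB ?bnd_simp//; last first.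
  exact: rate_integrable.
by rewrite Rintegral_itv_bndo_bndc//; exact: rate_integrable.
Qed.

Lemma le_received j u v : u <= v -> received x j u <= received x j v.
Proof.
have H u' v' : 0 <= u' -> u' <= v' -> received x j u' <= received x j v'.
  move=> u0 uv; rewrite -subr_ge0 receivedB//; apply: Rintegral_ge0 => s _.
  exact: sched_ge0 xP _ _.
move=> uv; have [v0|v0] := leP v 0.
  by rewrite !received_at_le0// (le_trans uv).
have [u0|u0] := leP 0 u; first exact: H.
by rewrite (received_at_le0 j (ltW u0)) -(received_at_le0 j (lexx 0)) H// ltW.
Qed.

Lemma received_ge0 j t : 0 <= received x j t.
Proof.
have [t0|t0] := leP 0 t; last by rewrite received_at_le0// ltW.
by rewrite -(received_at_le0 j (lexx 0)) le_received.
Qed.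

Lemma sum_receivedB (P : pred J) u v : 0 <= u -> u <= v ->
  \sum_(j | P j) (received x j v - received x j u) =
  \int[mu]_(s in `]u, v[) \sum_(j | P j) x j s.
Proof.
move=> u0 uv; rewrite Rintegral_sum//; last by move=> j; exact: rate_integrable.
by apply: eq_bigr => j _; exact: receivedB.
Qed.

Lemma length_itv_oo u v : u <= v -> fine (mu `]u, v[) = v - u.
Proof.
rewrite le_eqVlt => /predU1P[->|uv].
  by rewrite set_itv_ge ?bnd_simp ?ltxx// measure0/= subrr.
by rewrite lebesgue_measure_itv/= lte_fin uv.
Qed.

Lemma sum_received_le (P : pred J) u v : 0 <= u -> u <= v ->
  \sum_(j | P j) (received x j v - received x j u) <= v - u.
Proof.
move=> u0 uv; rewrite sum_receivedB//.
apply: (@le_trans _ _ (\int[mu]_(s in `]u, v[) 1)).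
  apply: le_Rintegral => //.
  - apply: bounded_integrable_itv => [|s].
      under eq_fun => s do rewrite -big_filter.
      by apply: measurable_sum => j; exact: sched_measurable xP _.
    rewrite ger0_norm ?sum_rate_le1//.
    by apply: sumr_ge0 => j _; exact: sched_ge0 xP _ _.
  - by apply: bounded_integrable_itv => // t; rewrite normr1.
  - by move=> s _; exact: sum_rate_le1.
by rewrite Rintegral_cst// mul1r length_itv_oo.
Qed.

Lemma received_lipschitz j u v : 0 <= u -> u <= v ->
  received x j v - received x j u <= v - u.
Proof.
move=> u0 uv; have := @sum_received_le (pred1 j) u v u0 uv.
by rewrite big_pred1_eq.
Qed.

Lemma sum_received_busy u v : 0 <= u -> u <= v ->
  (forall s, u < s < v -> \sum_j x j s = 1) ->
  \sum_j (received x j v - received x j u) = v - u.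
Proof.
move=> u0 uv H; rewrite sum_receivedB//.
rewrite (@eq_Rintegral _ _ _ _ _ (fun=> 1)).
  by rewrite Rintegral_cst// mul1r length_itv_oo.
by move=> s; rewrite inE/= in_itv/= => /H.
Qed.

Lemma received_idle j u v : 0 <= u -> u <= v ->
  (forall s, u < s < v -> x j s = 0) -> received x j v = received x j u.
Proof.
move=> u0 uv H; apply/eqP; rewrite -subr_eq0 receivedB//; apply/eqP.
rewrite (@eq_Rintegral _ _ _ _ _ (fun=> 0)).
  by rewrite Rintegral_cst// mul0r.
by move=> s; rewrite inE/= in_itv/= => /H.
Qed.

Lemma received_unreleased j t : t <= release I j -> received x j t = 0.
Proof.
move=> tr; have [t0|t0] := leP t 0; first exact: received_at_le0.
rewrite (@received_idle j 0 t) ?(ltW t0)//; first exact: received_at_le0.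
by move=> s /andP[_ st]; apply: sched_release xP _ _ (lt_le_trans st tr).
Qed.

Lemma continuous_received j : continuous (received x j).
Proof.
have lip u v : `|received x j u - received x j v| <= `|u - v|.
  wlog uv : u v / u <= v.
    move=> H; have [/H//|/ltW/H] := leP u v.
    by rewrite distrC [leRHS]distrC.
  rewrite distrC [leRHS]distrC !ger0_norm ?subr_ge0 ?le_received//.
  have [u0|u0] := leP 0 u; first exact: received_lipschitz.
  rewrite (received_at_le0 j (ltW u0)).
  have [v0|v0] := leP v 0; first by rewrite received_at_le0// !subrr subr_ge0.
  have := received_lipschitz j (lexx 0) (ltW v0).
  by rewrite (received_at_le0 j (lexx 0)) => /le_trans; apply; lra.
move=> t; apply/cvgrPdist_lt => e e0; near=> s.
apply: le_lt_trans (lip _ _) _; near: s.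
exact: cvgr_dist_lt.
Unshelve. all: by end_near. Qed.

(** Needed for tied known jobs: ties are broken arbitrarily, and the machine may switch between two
    such jobs so erratically that neither runs alone on any interval. *)
Lemma received_eq_gap i j u v : 0 <= u -> u < v ->
  (forall s, u < s < v -> x i s * x j s = 0) ->
  (forall s, u <= s <= v ->
     received x i s - received x j s = received x i u - received x j u) ->
  received x i v = received x i u.
Proof.
move=> u0 uv dij gap; apply/eqP; rewrite -subr_eq0.
rewrite (receivedB _ u0 (ltW uv)); apply/eqP.
have x01 k s : 0 <= x k s <= 1 by rewrite (sched_ge0 xP) rate_le1.
by apply: (integral_eq_disjoint u0 uv _ _ (x01 i) (x01 j) dij gap);
  exact: sched_measurable xP _.
Qed.

End Schedules.

(** * Lower bound and credit of a single job *)

Section Credit.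
Variables (R : realType) (eps : R).
Hypotheses (eps_gt0 : 0 < eps) (eps_lt1 : eps < 1).
Implicit Types p e th : R.

Definition lower_bound p e : R := Num.min (eps / (1 - eps) * e) (p - e).

(** A job of length [th / eps] has remaining time [th] exactly when it becomes known. A longer job
    is charged like one of this length until its lower bound reaches [th], keeps credit [th] while
    the bound is above [th], and then has its true remaining time as credit. *)
Definition credit p e th : R :=
  Num.max (Num.min p (th / eps) - e) (Num.min (p - e) th).

Lemma le_lower_bound p e th :
  (th <= lower_bound p e) = (th * (1 - eps) <= eps * e) && (th <= p - e).
Proof.
have e1 : 0 < 1 - eps by rewrite subr_gt0.
by rewrite /lower_bound le_min -mulrAC ler_pdivlMr.
Qed.

Lemma lt_lower_bound p e th :
  (th < lower_bound p e) = (th * (1 - eps) < eps * e) && (th < p - e).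
Proof.
have e1 : 0 < 1 - eps by rewrite subr_gt0.
by rewrite /lower_bound lt_min -mulrAC ltr_pdivlMr.
Qed.

Lemma credit_lower_bound p e th : th <= lower_bound p e -> credit p e th = th.
Proof.
move: eps_gt0 eps_lt1 => eps0 eps1.
rewrite le_lower_bound => /andP[h1 h2]; rewrite /credit (min_r h2).
apply: max_r; rewrite lerBlDr ge_min; apply/orP; right.
by rewrite ler_pdivrMr//; nra.
Qed.

Lemma credit_small p e th : p - e <= th -> credit p e th = p - e.
Proof.
move=> h; rewrite /credit (min_l h); apply: max_r.
by rewrite lerD2r ge_min lexx.
Qed.

Lemma le_credit p e th : th <= p - e -> th <= credit p e th.
Proof. by move=> h; rewrite /credit le_max le_min h lexx orbT. Qed.

Lemma credit_le_proc p th : credit p 0 th <= p.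
Proof. by rewrite /credit !subr0 ge_max !ge_min lexx. Qed.

Lemma credit_le_divr p th : 0 <= th -> credit p 0 th <= th / eps.
Proof.
move: eps_gt0 eps_lt1 => eps0 eps1 th0.
rewrite /credit !subr0 ge_max !ge_min lexx orbT/=.
by apply/orP; right; rewrite ler_pdivlMr//; nra.
Qed.

Lemma le_credit_received p e1 e2 th : e1 <= e2 -> credit p e2 th <= credit p e1 th.
Proof.
move=> e12; rewrite /credit ge_max !le_max lerD2l lerN2 e12/=.
apply/orP; right; rewrite le_min !ge_min lexx orbT andbT.
by rewrite lerD2l lerN2 e12.
Qed.

(* As a function of [e] the credit decreases with slope 1, except that it is
   flat on the interval where the lower bound exceeds [th]. *)
Lemma credit_processed p e1 e2 th : 0 <= th -> e1 <= e2 -> e2 <= p ->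
  (forall e, e1 < e < e2 -> lower_bound p e <= th) ->
  credit p e2 th + (e2 - e1) <= credit p e1 th.
Proof.
move: eps_gt0 eps_lt1 => eps0 eps1 th0 e12 e2p H.
have [pa|ap] := leP p (th / eps).
  have E e : credit p e th = p - e.
    by rewrite /credit (min_l pa); apply: max_l; rewrite ge_min lexx.
  by rewrite !E; lra.
set a := th / eps in ap; have tha : th = eps * a by rewrite /a; field; lra.
(* The lower bound exceeds [th] strictly between the amounts [(1 - eps) * a] and [p - th]. *)
have [h|h] := leP e2 ((1 - eps) * a).
  have E e : e <= (1 - eps) * a -> credit p e th = a - e.
    move=> ea; rewrite /credit -/a (min_r (ltW ap)); apply: max_l.
    by rewrite ge_min; apply/orP; right; lra.
  by rewrite !E//; lra.
have [h'|h'] := leP (p - e1) th.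
  by rewrite !credit_small//; lra.
have [->|ne] := eqVneq e1 e2; first by lra.
have lt12 : e1 < e2 by rewrite lt_neqAle ne.
(* In the remaining case this flat interval meets the one from [e1] to [e2]; the midpoint of the
   overlap contradicts [H]. *)
pose lo := Num.max e1 ((1 - eps) * a); pose hi := Num.min e2 (p - th).
have lohi : lo < hi.
  by rewrite /lo /hi gt_max !lt_min lt12 h /=; apply/andP; split; lra.
have := midf_lt lohi; set e := (lo + hi) / 2 => -[l1 l2].
move: l1 l2; rewrite /lo /hi gt_max lt_min => /andP[l1 l2] /andP[l3 l4].
have := H e; rewrite l1 l3 => /(_ isT); rewrite leNgt lt_lower_bound => /negP[].
by apply/andP; split; [rewrite tha; nra|lra].
Qed.

Lemma continuous_credit p e : continuous (credit p e).
Proof.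
move=> th.
apply: (@continuous_max _ _ (fun t : R => Num.min p (t / eps) - e)
  (fun t : R => Num.min (p - e) t)); last first.
  by apply: (@continuous_min _ _ (fun=> p - e) (fun t : R => t));
    [exact: cvg_cst|exact: cvg_id].
apply: (@cvgB _ R^o); last exact: cvg_cst.
apply: (@continuous_min _ _ (fun=> p) (fun t : R => t / eps)).
  exact: cvg_cst.
exact: mulrr_continuous.
Qed.

End Credit.

(** * The SLF rule at a single time *)

Section Rule.
Variables (R : realType) (eps : R).
Hypotheses (eps_gt0 : 0 < eps) (eps_lt1 : eps < 1).
Variables (J : finType) (I : instance R J) (x : J -> R -> R).
Implicit Types (i j : J) (s t : R) (A : {set J}).

Definition job_bound j t : R := lower_bound eps (proc I j) (received x j t).

(** Being known amounts to [p - e <= eps / (1 - eps) * e], so the estimate is always the smaller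
    term of the minimum. *)
Lemma estimate_active j t : j \in active I x t ->
  estimate I eps x j t = job_bound j t.
Proof.
move: eps_gt0 eps_lt1 => eps0 eps1 ja; have e1 : 0 < 1 - eps by lra.
rewrite /estimate /job_bound /lower_bound inE ja/= /remaining.
case: ifPn => [|/negPn] h.
  rewrite min_l// -mulrAC ler_pdivrMr//; move: h; rewrite -ltNge; nra.
by rewrite min_r// -mulrAC ler_pdivlMr//; nra.
Qed.

Lemma min_estimate_le A j t : j \in A ->
  (min_estimate I eps x t A <= (estimate I eps x j t)%:E)%E.
Proof. by move=> jA; exact: bigmin_le_cond. Qed.

Lemma argmin_estimate_neq0 A t : A != finset.set0 ->
  exists j, j \in argmin_estimate I eps x t A.
Proof.
case/set0Pn => j jA; pose F i := (estimate I eps x i t)%:E.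
have [i iA minE] := @eq_bigmin _ _ _ +oo%E j (mem A) F jA (fun i _ => leey _).
by exists i; rewrite inE iA; exact/eqP/esym.
Qed.

Variable t : R.
Hypothesis rule : SLF_rule I eps x t.

Lemma SLF_busy : \sum_j x j t = 1.
Proof.
move: rule; rewrite /SLF_rule; case: ifPn => [_ [k _ xE]|].
  by under eq_bigr do rewrite xE; rewrite -big_mkcond big_pred1_eq.
rewrite -ltNge => UK xE.
(* The second branch requires the minimum over unknown jobs to be below [+oo]. *)
have /(@argmin_estimate_neq0 _ t)[j ja] : unknown I eps x t != finset.set0.
  by apply/eqP => U0; move: UK; rewrite U0 /min_estimate big_set0 ltNge leey.
under eq_bigr do rewrite xE; rewrite -big_mkcond sumr_const.
rewrite -[LHS]mulr_natr mulVf// pnatr_eq0 -lt0n card_gt0.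
by apply/set0Pn; exists j.
Qed.

Lemma in_active_split i : i \in active I x t ->
  (i \in known I eps x t) || (i \in unknown I eps x t).
Proof. by move=> ia; rewrite inE [in X in _ || X]inE ia/= orbN. Qed.

Lemma argmin_bound_le A i j : j \in argmin_estimate I eps x t A ->
  j \in active I x t -> i \in active I x t ->
  (min_estimate I eps x t A <= (estimate I eps x i t)%:E)%E ->
  job_bound j t <= job_bound i t.
Proof.
rewrite inE => /andP[_ /eqP <-] ja ia.
by rewrite lee_fin !estimate_active.
Qed.

(** In both branches the processed jobs attain the minimum estimate over known and unknown jobs
    together. *)
Lemma SLF_processed i j : i \in active I x t -> x j t != 0 ->
  job_bound j t <= job_bound i t.
Proof.
move=> ia; move: rule; rewrite /SLF_rule.
have sub (p : pred J) k : k \in [set k in active I x t | p k]%SET ->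
  k \in active I x t by rewrite inE => /andP[].
case: ifPn => [KU [k ka xE]|].
  rewrite xE; have [-> _|] := eqVneq j k; last by rewrite eqxx.
  have kK : k \in known I eps x t by move: ka; rewrite inE => /andP[].
  apply: (argmin_bound_le ka (sub _ _ kK) ia).
  have /orP[iK|iU] := in_active_split ia; first exact: min_estimate_le.
  exact/(le_trans KU)/min_estimate_le.
rewrite -ltNge => UK xE; rewrite xE; case: ifPn => [ja _|]; last by rewrite eqxx.
have jU : j \in unknown I eps x t by move: ja; rewrite inE => /andP[].
apply: (argmin_bound_le ja (sub _ _ jU) ia).
have /orP[iK|iU] := in_active_split ia; last exact: min_estimate_le.
exact/(le_trans (ltW UK))/min_estimate_le.
Qed.

(** A known job is processed only in the first branch, and then alone. *)
Lemma SLF_known_disjoint i j : i \in known I eps x t -> i != j ->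
  x i t * x j t = 0.
Proof.
move=> iK ij; move: rule; rewrite /SLF_rule; case: ifPn => [_ [k _ xE]|_ xE].
  rewrite !xE; have [ik|_] := eqVneq i k; last by rewrite mul0r.
  by rewrite -ik eq_sym (negbTE ij) mulr0.
rewrite xE ifN ?mul0r//; apply/negP; rewrite inE => /andP[+ _].
by move: iK; rewrite !inE => /andP[_ ->]; rewrite andbF.
Qed.

End Rule.

(** * Evolution of jobs in the SLF schedule *)

Section Run.
Variables (R : realType) (eps : R).
Hypotheses (eps_gt0 : 0 < eps) (eps_lt1 : eps < 1).
Variables (J : finType) (I : instance R J) (x : J -> R -> R).
Hypotheses (xP : is_schedule I x)
  (rule : forall t, active I x t != finset.set0 -> SLF_rule I eps x t).
Implicit Types (i j : J) (s t u v : R).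

Notation bound := (job_bound eps I x).
Notation got := (received x).

Lemma job_bound_known j t : j \in known I eps x t -> bound j t = proc I j - got j t.
Proof.
move=> jK; have ja : j \in active I x t by move: jK; rewrite inE => /andP[].
rewrite -(estimate_active eps_gt0 eps_lt1 ja) /estimate ifN//.
by move: jK; rewrite !inE => /andP[_ ->]; rewrite andbF.
Qed.

Lemma continuous_job_bound j : continuous (bound j).
Proof.
move=> t; apply: (@continuous_min _ _ (fun s => eps / (1 - eps) * got j s)
  (fun s => proc I j - got j s)).
  apply: (@cvgM _ R^o); first exact: cvg_cst.
  exact: continuous_received xP _ _.
apply: (@cvgB _ R^o); first exact: cvg_cst.
exact: continuous_received xP _ _.
Qed.

Lemma received_IVT j u v e : u <= v -> got j u <= e <= got j v ->
  exists2 s, u <= s <= v & got j s = e.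
Proof.
move=> uv h; have [| |s su <-] := @IVT R (got j) u v e uv.
- exact/continuous_subspaceT/(continuous_received xP).
- by have le := le_received xP j uv; rewrite min_l// max_r.
by exists s => //; move: su; rewrite in_itv.
Qed.

(* While [i] is available with lower bound at most [th], only jobs with lower
   bound at most [th] are processed, so [received x j] cannot cross a value at
   which the lower bound of [j] exceeds [th]. *)
Lemma credit_run j u v th : 0 <= u -> u <= v -> 0 <= th ->
  (forall s, u < s < v -> exists2 i, i \in active I x s & bound i s <= th) ->
  credit eps (proc I j) (got j v) th + (got j v - got j u)
    <= credit eps (proc I j) (got j u) th.
Proof.
move=> u0 uv th0 H; apply: credit_processed => //.
- exact: le_received xP _ _ _ uv.
- exact: sched_proc xP _ _.
move=> e /andP[ue ev]; rewrite leNgt; apply/negP.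
rewrite lt_lower_bound// => /andP[l1 l2].
(* The lower bound of [j] exceeds [th] for all amounts from [e] to [e'], so [j] would be idle
   between the times at which it has received [e] and [e']. *)
pose e' := (e + Num.min (got j v) (proc I j - th)) / 2.
have m1 : e < Num.min (got j v) (proc I j - th) by rewrite lt_min ev/=; lra.
have [] := midf_lt m1; rewrite -/e' lt_min => ee' /andP[e'v e'p].
have [s /andP[us sv] es] : exists2 s, u <= s <= v & got j s = e.
  by apply: received_IVT => //; rewrite !ltW.
have [s' /andP[ss' sv'] es'] : exists2 s', s <= s' <= v & got j s' = e'.
  by apply: received_IVT => //; rewrite es !ltW.
have : got j s' = got j s.
  apply: (received_idle xP) => //; first exact: le_trans u0 us.
  move=> w /andP[sw ws']; apply/eqP/negP => /negP xw.
  have [|i ia bi] := H w.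
    by rewrite (le_lt_trans us sw) (lt_le_trans ws' sv').
  have act : active I x w != finset.set0 by apply/set0Pn; exists i.
  have := SLF_processed eps_gt0 eps_lt1 (rule act) ia xw.
  move=> /le_trans/(_ bi); rewrite leNgt => /negP; apply.
  rewrite /job_bound lt_lower_bound//.
  have g1 := le_received xP j (ltW sw); have g2 := le_received xP j (ltW ws').
  move: eps_gt0 l1 l2; rewrite es in g1; rewrite es' in g2 => ? ? ?.
  by apply/andP; split; [nra|lra].
by rewrite es es' => ee; move: ee'; rewrite ee ltxx.
Qed.

(** For known jobs the lower bound is the remaining time. That of [i] never grows, so [j] could only
    progress by running while its own is still the larger one. *)
Lemma known_idle i j u v : 0 <= u -> u <= v ->
  (forall s, u < s < v -> (i \in known I eps x s) && (j \in known I eps x s)) ->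
  proc I i - got i u < proc I j - got j u -> got j v = got j u.
Proof.
move=> u0 uv K; set g := proc I j - got j u - (proc I i - got i u) => lt_ij.
apply/eqP; rewrite eq_le (le_received xP _ uv) andbT leNgt; apply/negP => lt_uv.
(* Up to the amount [e] at most half of the gap [g] is used up. *)
pose e := Num.min (got j v) (got j u + g / 2).
have ue : got j u < e by rewrite /e lt_min lt_uv/= /g; lra.
have [w /andP[uw wv] we] : exists2 w, u <= w <= v & got j w = e.
  by apply: received_IVT => //; rewrite (ltW ue) ge_min lexx.
have : got j w = got j u.
  apply: (received_idle xP) => // s /andP[us sw]; apply/eqP/negP => /negP xs.
  have /andP[iK jK] := K s (introT andP (conj us (lt_le_trans sw wv))).
  have ia : i \in active I x s by move: iK; rewrite inE => /andP[].
  have act : active I x s != finset.set0 by apply/set0Pn; exists i.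
  have := SLF_processed eps_gt0 eps_lt1 (rule act) ia xs.
  rewrite !job_bound_known// leNgt => /negP; apply.
  have g1 := le_received xP i (ltW us); have g2 := le_received xP j (ltW sw).
  have : e <= got j u + g / 2 by rewrite /e ge_min lexx orbT.
  by rewrite /g; lra.
by rewrite we => eu; move: ue; rewrite eu ltxx.
Qed.

(* If the two remaining times differ, the larger one is frozen; if they agree
   all along, [received_eq_gap] shows that neither job was processed. *)
Lemma known_tie i j u v th : 0 <= u -> u < v -> i != j ->
  (forall s, u < s < v -> (i \in known I eps x s) && (j \in known I eps x s)) ->
  proc I i - got i v = th -> proc I j - got j v = th ->
  (proc I i - got i u <= th) || (proc I j - got j u <= th).
Proof.
move=> u0 uv ij K ri rj.
have [//|lti] := leP (proc I i - got i u) th; have [//|ltj] := leP _ th.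
have Ks s : u <= s -> forall w, s < w < v ->
    (i \in known I eps x w) && (j \in known I eps x w).
  by move=> us w /andP[sw wv]; apply: K; rewrite (le_lt_trans us sw).
have eqr s : u <= s <= v -> proc I i - got i s = proc I j - got j s.
  move=> /andP[us sv]; have s0 := le_trans u0 us.
  have gi := le_received xP i sv; have gj := le_received xP j sv.
  have [lt|lt|//] := ltgtP (proc I i - got i s) (proc I j - got j s).
    by have := known_idle s0 sv (Ks s us) lt; lra.
  have K' w : s < w < v -> (j \in known I eps x w) && (i \in known I eps x w).
    by move=> /(Ks s us); rewrite andbC.
  by have := known_idle s0 sv K' lt; lra.
have : got i v = got i u.
  apply: (@received_eq_gap _ _ _ _ xP i j) => // s su.
    have /andP[iK _] := K s su.
    have act : active I x s != finset.set0.
      by apply/set0Pn; exists i; move: iK; rewrite inE => /andP[].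
    exact: (SLF_known_disjoint (rule act) iK ij).
  by have := eqr s su; have := eqr u; rewrite lexx (ltW uv) => /(_ isT); lra.
by lra.
Qed.

End Run.

(** * The excess and its evolution *)

Section Comparison.
Variables (R : realType) (eps : R).
Hypotheses (eps_gt0 : 0 < eps) (eps_lt1 : eps < 1).
Variables (J : finType) (I : instance R J) (x y : J -> R -> R).
Hypotheses (xP : is_schedule I x)
  (rule : forall t, active I x t != finset.set0 -> SLF_rule I eps x t).
Hypothesis yP : is_schedule I y.
Variables (k : nat) (Q : {set J}).
Hypothesis eps_k : eps^-1 <= k%:R.
Implicit Types (i j : J) (s t u v th : R) (A : {set J}).

Notation bound := (job_bound eps I x).
Notation got := (received x).

Definition excess A th s : R :=
  \sum_(j in A) (credit eps (proc I j) (got j s) th -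
    (if j \in Q then k%:R * th else proc I j - received y j s)).

(** Two sets are needed because the excess may jump at a release: [released_before b] describes the
    situation just before the arrivals at time [b]. *)
Definition released_by b : {set J} := [set j | release I j <= b]%SET.
Definition released_before b : {set J} := [set j | release I j < b]%SET.

Lemma excessE A th s : excess A th s =
  \sum_(j in A) credit eps (proc I j) (got j s) th
  - (#|A :&: Q| * k)%:R * th
  - \sum_(j in A :\: Q) (proc I j - received y j s).
Proof.
rewrite /excess sumrB -addrA -opprD; congr (_ - _).
rewrite (big_setID Q)/=; congr (_ + _).
  rewrite (eq_bigr (fun=> k%:R * th)).
    by rewrite sumr_const natrM -mulrA -[LHS]mulr_natl.
  by move=> j; rewrite inE => /andP[_ ->].
by apply: eq_bigr => j; rewrite inE => /andP[/negbTE ->].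
Qed.

Lemma continuous_excess A s : continuous (excess A ^~ s).
Proof.
apply: continuous_big; first exact: add_continuous.
move=> j _ th; apply: (@cvgB _ R^o); first exact: continuous_credit.
case: ifP => _; last exact: cvg_cst.
exact: mulrl_continuous.
Qed.

(** An arriving job has received nothing in either schedule. Outside [Q] its credit is covered by
    its full volume in [y]; inside [Q] its credit is at most [th / eps], hence at most [k%:R * th],
    which is where the size of [k] enters. *)
Lemma excess_arrival b th : 0 <= th ->
  excess (released_by b) th b <= excess (released_before b) th b.
Proof.
move=> th0; rewrite /excess [leRHS]big_mkcond [leLHS]big_mkcond/=.
apply: ler_sum => j _; rewrite !inE; have [_|_|jb] //= := ltgtP (release I j) b.
have gj : got j b = 0 by apply: (received_unreleased xP); rewrite jb.
have gy : received y j b = 0 by apply: (received_unreleased yP); rewrite jb.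
rewrite gj gy subr_le0; case: ifP => _; last by rewrite subr0 credit_le_proc.
apply: le_trans (credit_le_divr eps_gt0 eps_lt1 _ th0) _.
by rewrite mulrC ler_wpM2r.
Qed.

Lemma excess_release0 th : 0 <= th -> excess (released_by 0) th 0 <= 0.
Proof.
move=> /excess_arrival/le_trans; apply; rewrite /excess big1// => j.
by rewrite inE ltNge release_ge0.
Qed.

Lemma excess_run b u th : 0 <= u -> u < b -> 0 <= th ->
  (forall s, u < s < b -> exists2 i, i \in active I x s & bound i s <= th) ->
  excess (released_before b) th b <= excess (released_before b) th u.
Proof.
move=> u0 ub th0 H; set A := released_before b.
have h1 : \sum_(j in A) (got j b - got j u) = b - u.
  rewrite -(sum_received_busy xP u0 (ltW ub)); last first.
    move=> s /H[i ia _]; apply: (@SLF_busy _ eps _ I).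
    by apply: rule; apply/set0Pn; exists i.
  (* Jobs outside [A] are released at [b] or later, so all the work goes to [A]. *)
  rewrite [RHS](bigID (mem A))/= [X in _ = _ + X]big1 ?addr0// => j.
  rewrite inE -leNgt => bj; rewrite !(received_unreleased xP) ?subrr//.
  exact: le_trans (ltW ub) bj.
have h2 : \sum_(j in A :\: Q) (received y j b - received y j u) <= b - u.
  exact: (sum_received_le yP _ u0 (ltW ub)).
have h3 : \sum_(j in A) (credit eps (proc I j) (got j b) th + (got j b - got j u))
    <= \sum_(j in A) credit eps (proc I j) (got j u) th.
  apply: ler_sum => j _.
  exact: (credit_run eps_gt0 eps_lt1 xP rule _ u0 (ltW ub) th0 H).
rewrite big_split/= in h3; rewrite !excessE; move: h1 h2 h3; rewrite !sumrB; lra.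
Qed.

(** For a fixed set [A] only the progress of [y] can raise the excess. The bound is uniform in [th],
    which is what makes the infimum in [excess_le0] attained. *)
Lemma excess_right A th s v : 0 <= s -> s <= v ->
  excess A th v <= excess A th s + (v - s).
Proof.
move=> s0 sv; rewrite !excessE.
have h2 : \sum_(j in A :\: Q) (received y j v - received y j s) <= v - s.
  exact: (sum_received_le yP _ s0 sv).
have h3 : \sum_(j in A) credit eps (proc I j) (got j v) th
    <= \sum_(j in A) credit eps (proc I j) (got j s) th.
  apply: ler_sum => j _; apply: le_credit_received.
  exact: le_received xP _ _ _ sv.
move: h2 h3; rewrite !sumrB; lra.
Qed.
End Comparison.

(** * Finding a level at which SLF works just before time [b] *)

Section Step.
Variables (R : realType) (eps : R).
Hypotheses (eps_gt0 : 0 < eps) (eps_lt1 : eps < 1).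
Variables (J : finType) (I : instance R J) (x y : J -> R -> R).
Hypotheses (xP : is_schedule I x)
  (rule : forall t, active I x t != finset.set0 -> SLF_rule I eps x t).
Hypothesis yP : is_schedule I y.
Variables (k : nat) (Q : {set J}).
Implicit Types (i j : J) (s t u v th : R) (A : {set J}).

Notation bound := (job_bound eps I x).
Notation got := (received x).
Notation excess := (excess eps I x y k Q).

Definition unfinished A s : {set J} := [set j in A | got j s < proc I j]%SET.

Lemma sum_credit_unfinished A s th : 0 <= th ->
  \sum_(j in A) credit eps (proc I j) (got j s) th =
  \sum_(j in unfinished A s) credit eps (proc I j) (got j s) th.
Proof.
move=> th0; rewrite [RHS]big_mkcond [LHS]big_mkcond; apply: eq_bigr => j _.
rewrite [in RHS]inE; case: (j \in A) => //=; case: ltP => // pj.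
have -> : got j s = proc I j by apply/le_anti; rewrite pj (sched_proc xP).
by rewrite credit_small subrr.
Qed.

Lemma unserved_ge0 A s : 0 <= \sum_(j in A) (proc I j - received y j s).
Proof. by apply: sumr_ge0 => j _; rewrite subr_ge0; exact: sched_proc yP _ _. Qed.

Lemma sum_credit_bound A s th : (forall j, j \in A -> th <= bound j s) ->
  \sum_(j in A) credit eps (proc I j) (got j s) th = #|A|%:R * th.
Proof.
move=> H; rewrite mulr_natl -sumr_const; apply: eq_bigr => j /H.
exact: credit_lower_bound.
Qed.

Variable b : R.
Notation A := (released_before I b).
Notation N := (unfinished A b).

Definition available th s := exists2 i, i \in active I x s & bound i s <= th.

Lemma near_active i : i \in N -> \forall s \near b^'-, i \in active I x s.
Proof.
rewrite inE => /andP[]; rewrite inE => ib gi; near=> s.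
rewrite inE; apply/andP; split; first by apply/ltW; near: s; exact: nbhs_left_gt.
apply: le_lt_trans gi; apply: le_received xP _ _ _ _; apply: ltW.
by near: s; exact: nbhs_left_lt.
Unshelve. all: by end_near. Qed.

Lemma near_available_lt i th : i \in N -> bound i b < th ->
  \forall s \near b^'-, available th s.
Proof.
move=> iN lt; near=> s; exists i; first by near: s; exact: near_active.
apply: ltW; near: s.
have /cvg_at_left_filter/cvgr_lt := @continuous_job_bound R eps J I x xP i b.
exact.
Unshelve. all: by end_near. Qed.

(** This term of the lower bound is nondecreasing in time, so a weak inequality at [b] suffices,
    whereas [near_available_lt] relies on continuity and a strict one. *)
Lemma near_available_unknown i th : i \in N ->
  eps / (1 - eps) * got i b <= th -> \forall s \near b^'-, available th s.
Proof.
move=> iN le; near=> s; exists i; first by near: s; exact: near_active.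
have sb : s <= b by apply: ltW; near: s; exact: nbhs_left_lt.
rewrite /job_bound /lower_bound ge_min; apply/orP; left; apply: le_trans le.
apply: ler_wpM2l; first by rewrite divr_ge0 ?subr_ge0 ?ltW.
exact: le_received xP _ _ _ sb.
Unshelve. all: by end_near. Qed.

Lemma near_known i : i \in N ->
  proc I i - got i b < eps / (1 - eps) * got i b ->
  \forall s \near b^'-, i \in known I eps x s.
Proof.
move=> iN lt; near=> s; rewrite inE; apply/andP; split.
  by near: s; exact: near_active.
rewrite /remaining lerBlDr -lerBlDl; apply: ltW; near: s.
have /cvg_at_left_filter/cvgr_gt := @continuous_received R J I x xP i b.
apply; move: lt; rewrite -mulrAC ltr_pdivlMr ?subr_gt0//.
by move: eps_gt0 eps_lt1 => ? ? ?; lra.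
Unshelve. all: by end_near. Qed.

Lemma near_left_itv (P : set R) : 0 < b -> (\forall s \near b^'-, P s) ->
  exists2 u, 0 <= u < b & forall s, u < s < b -> P s.
Proof.
move=> b0 [e /= e0 He]; exists (Num.max 0 (b - e)).
  by rewrite le_max lexx gt_max b0 ltrBlDr ltrDl e0.
move=> s; rewrite gt_max => /andP[/andP[_ bs] sb]; apply: He => //=.
by rewrite ltr_norml; apply/andP; split; lra.
Qed.

(** If the processed amount of one job gives its bound [th], monotonicity suffices. Otherwise both
    jobs are known near [b] with remaining time [th] at [b], and [known_tie] applies from each
    nearby [s] to [b]. *)
Lemma near_available_tie i j th : 0 < b -> i \in N -> j \in N -> i != j ->
  bound i b = th -> bound j b = th -> \forall s \near b^'-, available th s.
Proof.
move=> b0 iN jN ij bi bj.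
have [li|li] := leP (eps / (1 - eps) * got i b) th.
  exact: near_available_unknown li.
have [lj|lj] := leP (eps / (1 - eps) * got j b) th.
  exact: near_available_unknown lj.
have rE l : bound l b = th -> th < eps / (1 - eps) * got l b ->
    proc I l - got l b = th.
  rewrite /job_bound /lower_bound => <-; rewrite gt_min ltxx/= => lt.
  by rewrite min_r// ltW.
have ri := rE _ bi li; have rj := rE _ bj lj.
have [u /andP[u0 ub] K] : exists2 u, 0 <= u < b & forall s, u < s < b ->
    (i \in known I eps x s) && (j \in known I eps x s).
  apply: near_left_itv => //; near=> s; apply/andP; split; near: s.
    by apply: near_known => //; rewrite ri.
  by apply: near_known => //; rewrite rj.
near=> s; have us : u < s by near: s; exact: nbhs_left_gt.
have sb : s < b by near: s; exact: nbhs_left_lt.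
have K' w : s < w < b -> (i \in known I eps x w) && (j \in known I eps x w).
  by move=> /andP[sw wb]; apply: K; rewrite (lt_trans us sw).
have := known_tie eps_gt0 eps_lt1 xP rule (ltW (le_lt_trans u0 us)) sb ij K' ri rj.
move=> /orP[h|h]; [exists i|exists j];
  by [near: s; exact: near_active|rewrite /job_bound /lower_bound ge_min h orbT].
Unshelve. all: by end_near. Qed.

Lemma excess_bound th : 0 <= th -> (forall j, j \in N -> th <= bound j b) ->
  excess A th b = #|N|%:R * th - (#|A :&: Q| * k)%:R * th
    - \sum_(j in A :\: Q) (proc I j - received y j b).
Proof.
move=> th0 H; rewrite excessE sum_credit_unfinished// sum_credit_bound//.
Qed.

(* At a maximizer [th] of the excess just before time [b], some job with lower
   bound at most [th] is available. Otherwise the excess is affine near [th]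
   with positive slope, so [th] is the minimum lower bound; a unique job
   attaining it lets us increase [th] without decreasing the excess, and for
   tied jobs [near_available_tie] applies. *)
Lemma excess_available M c th0 : 0 < b -> (forall j, proc I j < M) -> 0 < c ->
  0 <= th0 <= M -> c <= excess A th0 b ->
  exists2 th, (0 <= th <= M) && (c <= excess A th b) &
    \forall s \near b^'-, available th s.
Proof.
move=> b0 pM c0 /andP[th00 th0M] cth0.
have [|th thM thmax] :=
    @EVT_max R (fun th => excess A th b) 0 M (le_trans th00 th0M).
  exact/continuous_subspaceT/continuous_excess.
have {}cth0 : c <= excess A th b.
  by apply: le_trans cth0 (thmax _ _); rewrite in_itv/= th00.
move: thM; rewrite in_itv/= => /andP[th_ge0 thM].
have [[i iN lt]|noi] := pselect (exists2 i, i \in N & bound i b < th).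
  by exists th; [rewrite th_ge0 thM|exact: near_available_lt lt].
have thN j : j \in N -> th <= bound j b.
  by move=> jN; rewrite leNgt; apply/negP => lt; apply: noi; exists j.
have cE := excess_bound th_ge0 thN.
have B0 := unserved_ge0 (A :\: Q) b.
set B := \sum_(j in A :\: Q) _ in cE B0; set q := (#|A :&: Q| * k)%N in cE.
(* The constant term [- B] is at most 0, so a positive excess forces a positive slope. *)
have qn : (q < #|N|)%N.
  by rewrite ltnNge; apply/negP; rewrite -(ler_nat R) => nq; nra.
have [i0 i0N] : exists i, i \in N.
  by apply/set0Pn; rewrite -card_gt0 (leq_ltn_trans _ qn).
case: (@arg_minP _ _ _ i0 (mem N) (fun j => bound j b) i0N) => i1 i1N' i1min.
have i1N : i1 \in N by [].
set th1 := bound i1 b in i1min.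
have th1_ge0 : 0 <= th1 by apply: le_trans th_ge0 (thN _ i1N).
have th1p : th1 <= proc I i1 - got i1 b.
  by rewrite /th1 /job_bound /lower_bound ge_min lexx orbT.
have th1M : th1 < M.
  have := pM i1; have := received_ge0 xP i1 b; lra.
have c1E := excess_bound th1_ge0 i1min; rewrite -/B -/q in c1E.
have qn1 : q%:R + 1 <= #|N|%:R :> R by rewrite natr1 ler_nat.
have c1 : c <= excess A th1 b.
  by have := thN _ i1N; rewrite -/th1 => ?; nra.
have [[j /andP[jN ij] bj]|noj] :=
    pselect (exists2 j, (j \in N) && (i1 != j) & bound j b = th1).
  exists th1; first by rewrite th1_ge0 (ltW th1M).
  exact: (near_available_tie b0 i1N jN ij).
have [unk|kn] := leP (eps / (1 - eps) * got i1 b) th1.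
  exists th1; first by rewrite th1_ge0 (ltW th1M).
  exact: near_available_unknown unk.
have r1 : proc I i1 - got i1 b = th1.
  rewrite /th1 /job_bound /lower_bound min_r//.
  by move: kn; rewrite /th1 /job_bound /lower_bound gt_min ltxx => /ltW.
(* The next lower bound after [th1], or [M] if that is smaller or absent. From [th1] to [th2] the
   credit of [i1] stays at [th1], and the slope drops by 1 only, hence remains nonnegative. *)
pose th2 := \big[Num.min/M]_(j in N :\ i1) bound j b.
have th12 : th1 < th2.
  apply/bigmin_gtP; split=> // j; rewrite in_setD1 => /andP[ji1 jN].
  rewrite lt_neqAle i1min// andbT; apply/eqP => e; apply: noj.
  by exists j => //; rewrite jN eq_sym.
have th2_ge0 : 0 <= th2 by apply: le_trans (ltW th12).
have th2M : th2 <= M by exact: bigmin_le_id.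
exists th2; last exact: (near_available_lt i1N).
rewrite th2_ge0 th2M/=; apply: le_trans c1 _.
rewrite c1E excessE -/B -/q sum_credit_unfinished// (big_setD1 i1)//=.
rewrite credit_small r1 ?(ltW th12)// sum_credit_bound; last first.
  by move=> j jN; apply: bigmin_le_cond.
have -> : #|N|%:R = 1 + #|N :\ i1|%:R :> R by rewrite (cardsD1 i1 N) i1N natrD.
have : q%:R <= #|N :\ i1|%:R :> R.
  by rewrite ler_nat; move: qn; rewrite (cardsD1 i1 N) i1N.
rewrite -subr_ge0 => /mulr_ge0 h; have := h (th2 - th1).
by rewrite subr_ge0 (ltW th12) => /(_ isT); lra.
Qed.

End Step.

(** * The first failure time and the count of active jobs *)

Section Conclusion.
Variables (R : realType) (eps : R).
Hypotheses (eps_gt0 : 0 < eps) (eps_lt1 : eps < 1).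
Variables (J : finType) (I : instance R J) (x y : J -> R -> R).
Hypotheses (xP : is_schedule I x)
  (rule : forall t, active I x t != finset.set0 -> SLF_rule I eps x t).
Hypothesis yP : is_schedule I y.
Variable k : nat.
Hypothesis eps_k : eps^-1 <= k%:R.
Implicit Types (j : J) (s t u th M c : R) (Q : {set J}).

Lemma excess_step Q M c b th0 : 0 < b -> (forall j, proc I j < M) -> 0 < c ->
  0 <= th0 <= M -> c <= excess eps I x y k Q (released_by I b) th0 b ->
  exists2 u, 0 <= u < b & exists2 th, 0 <= th <= M &
    c <= excess eps I x y k Q (released_by I u) th u.
Proof.
move=> b0 pM c0 th0M cth0; have /andP[th00 _] := th0M.
have {}cth0 := le_trans cth0 (excess_arrival eps_gt0 eps_lt1 xP yP Q eps_k b th00).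
have [th /andP[thM cth] av] :=
  excess_available eps_gt0 eps_lt1 xP rule yP b0 pM c0 th0M cth0.
have [u0 /andP[u00 u0b] H] := near_left_itv b0 av.
(* Starting no earlier than the last release before [b] keeps the set of released jobs constant on
   the way to [b]. *)
pose u := \big[Num.max/u0]_(j in released_before I b) release I j.
have u0u : u0 <= u by exact: bigmax_ge_id.
have ub : u < b by apply/bigmax_ltP; split=> // j; rewrite inE.
have rE : released_by I u = released_before I b.
  apply/setP => j; rewrite !inE; apply/idP/idP => [ru|rb].
    exact: le_lt_trans ru ub.
  by apply: le_bigmax_cond; rewrite inE.
have uge0 := le_trans u00 u0u; have /andP[th_ge0 _] := thM.
exists u; first by rewrite uge0.
exists th => //; rewrite rE; apply: le_trans cth _.
apply: (excess_run eps_gt0 eps_lt1 xP rule yP) => // s /andP[us sb].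
by apply: H; rewrite (le_lt_trans u0u us).
Qed.

Lemma released_by_right s : exists2 d, 0 < d &
  forall u, s <= u < s + d -> released_by I u = released_by I s.
Proof.
(* The distance to the next release, capped at 1. *)
pose d := \big[Num.min/1]_(j | s < release I j) (release I j - s).
exists d; first by apply/bigmin_gtP; split=> // j; rewrite subr_gt0.
move=> u /andP[su ud]; apply/setP => j; rewrite !inE.
apply/idP/idP => [ju|js]; last exact: le_trans js su.
rewrite leNgt; apply/negP => sj.
have : d <= release I j - s by exact: bigmin_le_cond.
by lra.
Qed.

(* The infimum of the times at which some excess is at least [c > 0] is
   attained, contradicting [excess_step] or [excess_release0]. *)
Lemma excess_le0 Q M t th : (forall j, proc I j < M) -> 0 <= t -> 0 <= th <= M ->
  excess eps I x y k Q (released_by I t) th t <= 0.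
Proof.
move=> pM t0 thM; set c := excess _ _ _ _ _ _ _ _ _.
rewrite leNgt; apply/negP => c0.
pose S : set R := [set a | 0 <= a /\ exists2 th, 0 <= th <= M &
  c <= excess eps I x y k Q (released_by I a) th a].
have St : S t by split=> //; exists th.
have lbS : lbound S 0 by move=> a [].
have infS : has_inf S by split; [exists t|exists 0].
have a0 : 0 <= inf S by apply: lb_le_inf => //; exists t.
have Sinf : S (inf S).
  split=> //; set a := inf S in a0 *.
  have M0 : 0 <= M by case/andP: thM => /le_trans; apply.
  have [|th' th'M th'max] := @EVT_max R
      (fun th => excess eps I x y k Q (released_by I a) th a) 0 M M0.
    exact/continuous_subspaceT/continuous_excess.
  exists th'; first by move: th'M; rewrite in_itv.
  (* If the largest excess [m] at [a] were below [c], then no release within [d] and growth at rate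
     at most 1 would keep every excess below [c] for a while after [a]. *)
  rewrite leNgt; apply/negP => lt_c; have [d d0 dE] := released_by_right a.
  set m := excess _ _ _ _ _ _ _ th' _ in th'max lt_c.
  have e0 : 0 < Num.min d (c - m) by rewrite lt_min d0 subr_gt0.
  have [v [v0 [th2 th2M cv]]] := inf_adherent e0 infS.
  rewrite -/a => va; have av : a <= v.
    by apply: ge_inf; [exists 0|split=> //; exists th2].
  have [vd vc] : v < a + d /\ v < a + (c - m).
    by split; apply: (lt_le_trans va); rewrite lerD2l ge_min lexx ?orbT.
  rewrite dE ?av// in cv.
  have h1 := excess_right eps xP yP k Q (released_by I a) th2 a0 av.
  have h2 := th'max th2; rewrite in_itv/= in h2; have {}h2 := h2 th2M.
  lra.
have [_ [th1 th1M c1]] := Sinf; have /andP[th10 _] := th1M.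
move: a0; rewrite le_eqVlt => /predU1P[a0|a0].
  have := excess_release0 eps_gt0 eps_lt1 xP yP Q eps_k th10.
  by rewrite a0; move: c1 c0; lra.
have [u /andP[u0 ua] [th2 th2M c2]] := excess_step a0 pM c0 th1M c1.
have : inf S <= u by apply: ge_inf; [exists 0|split=> //; exists th2].
by rewrite leNgt ua.
Qed.

Lemma active_le t : (#|active I x t| <= k * #|active I y t|)%N.
Proof.
have [t0|t0] := ltP t 0.
  rewrite (_ : active I x t = finset.set0) ?cards0//; apply/setP => j; rewrite !inE.
  by rewrite leNgt (lt_le_trans t0 (release_ge0 I j)).
set Q := active I y t; set A := released_by I t; set N := active I x t.
pose M := 1 + \sum_j proc I j.
have pM j : proc I j < M.
  rewrite /M (bigD1 j)//= addrCA ltrDl ltr_pwDl//.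
  by apply: sumr_ge0 => i _; exact/ltW/proc_gt0.
have M0 : 0 < M.
  by rewrite /M ltr_pwDl//; apply: sumr_ge0 => i _; exact/ltW/proc_gt0.
(* This level is at most every remaining time, so each active job has credit at least [th], and it
   is positive, so it can be cancelled at the end. *)
pose th := \big[Num.min/M]_(j in N) (proc I j - received x j t).
have th0 : 0 < th.
  by apply/bigmin_gtP; split=> // j; rewrite inE subr_gt0 => /andP[].
have thM : th <= M by exact: bigmin_le_id.
have := @excess_le0 Q M t th pM t0; rewrite (ltW th0) thM => /(_ isT).
rewrite excessE -/A (sum_credit_unfinished _ xP _ _ (ltW th0)).
have -> : unfinished I x A t = N by apply/setP => j; rewrite !inE.
have -> : A :&: Q = Q.
  by apply/finset.setIidPr/fintype.subsetP => j; rewrite !inE => /andP[].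
rewrite [X in _ - X]big1 => [|j]; last first.
  rewrite !inE => /andP[+ jt]; rewrite jt/= -leNgt => h; apply/eqP.
  by rewrite subr_eq0 eq_le h (sched_proc yP).
have : #|N|%:R * th <= \sum_(j in N) credit eps (proc I j) (received x j t) th.
  rewrite mulr_natl -sumr_const; apply: ler_sum => j jN.
  by apply: le_credit; exact: bigmin_le_cond.
rewrite -(ler_nat R) mulnC => h1 h2.
by rewrite -(ler_pM2r th0); lra.
Qed.

End Conclusion.

Theorem lemma3p1 (R : realType) (eps : R) (eps_gt0 : 0 < eps) (eps_lt1 : eps < 1)
    (J : finType) (I : instance R J) (slf opt : J -> R -> R)
    (slfP : is_SLF I eps slf) (optP : is_optimal I opt) (t : R) :
  #|active I slf t|%:Z <= Num.ceil (1 / eps) * #|active I opt t|%:Z.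
Proof.
have [slf_sched rule] := slfP; have [opt_sched _] := optP.
have ceil_ge0 : 0 <= Num.ceil (1 / eps).
  by rewrite -(ler_int R); apply: le_trans (ceil_ge _); rewrite divr_ge0 ?ltW.
have ceilE : Num.ceil (1 / eps) = `|Num.ceil (1 / eps)|%N by rewrite gez0_abs.
rewrite ceilE -PoszM lez_nat; apply: (active_le eps_gt0) => //.
by have := ceil_ge (1 / eps); rewrite {1}ceilE div1r.
Qed.
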